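(* Let $M\in\mathbb{R}^{d\times d}$ be Hurwitz and $C\in\mathbb{R}^{d\times n}$ with $(M,C)$ controllable, and write $M=(J-A)\Sigma^{-1}$ with $\Sigma,A,J$ as defined in the context. Let $b\in\mathbb{R}^k$ and let $K\in\mathbb{R}^{d\times d}$ be such that $-K_{11}\in\mathbb{R}^{k\times k}$ is Hurwitz, and such that, with $\alpha=-K_{21}K_{11}^{-1}$, $\hat M=\alpha M_{12}+M_{22}$ and $\hat C=(\alpha C_{11}+C_{21}\ \ \alpha C_{12}+C_{22})$, the matrix $\hat M$ is Hurwitz and $(\hat M,\hat C)$ is controllable. Let $\hat\mu^{\varepsilon=0}=\mathcal{N}(\hat m,\hat\Sigma)$ and $\mu_c=\mathcal{N}(m_c,\Sigma_c)$ be the Gaussian measures on $\mathbb{R}^{d-k}$ defined in the context. Then the following hold. (i) If $K=A-J$, then $\hat\mu^{\varepsilon=0}=\mu_c$. In particular, if $J=0$ and $K=A$, then $\hat\mu^{\varepsilon=0}=\mu_c$. (ii) If $K=\Sigma$, then $\hat\Sigma=\Sigma_c$. In general, $\hat m\ne m_c$ for $b\neq0$ (that is, there are data $M$, $C$, $K$, $b$ with $K=\Sigma$ and $b\ne0$, such that $M$ is Hurwitz, $(M,C)$ is controllable, $-K_{11}$ is Hurwitz, $\hat M$ is Hurwitz and $(\hat M,\hat C)$ is controllable, for which $\hat m\neq m_c$).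
   Context: Here $1\le k<d$. A matrix $S\in\mathbb{R}^{d\times d}$ is partitioned as $S=\begin{pmatrix}S_{11}&S_{12}\\S_{21}&S_{22}\end{pmatrix}$ with $S_{11}\in\mathbb{R}^{k\times k}$, $S_{22}\in\mathbb{R}^{(d-k)\times(d-k)}$. For $C\in\mathbb{R}^{d\times n}$ the rows are split in the same way and the columns into two consecutive groups, so that $\hat C\in\mathbb{R}^{(d-k)\times n}$ is the matrix of the last $d-k$ rows of $PC$, where $P=\begin{pmatrix}0&0\\\alpha&I\end{pmatrix}$. A matrix is Hurwitz if all its eigenvalues have strictly negative real part. A pair $(M,C)$ with $M\in\mathbb{R}^{r\times r}$ and $C$ having $r$ rows is controllable if $\mathrm{rank}[C,MC,\ldots,M^{r-1}C]=r$. Standing definitions: $\Sigma\in\mathbb{R}^{d\times d}$ is the unique symmetric positive definite solution of $M\Sigma+\Sigma M^T=-2CC^T$; $A:=CC^T$ is symmetric positive semidefinite; $J:=\frac12(M\Sigma-\Sigma M^T)$ is skew-symmetric; then $M=(J-A)\Sigma^{-1}$. The conditional measure $\mu_c=\mathcal{N}(m_c,\Sigma_c)$, with $m_c=\Sigma_{21}\Sigma_{11}^{-1}b$ and $\Sigma_c=\Sigma_{22}-\Sigma_{21}\Sigma_{11}^{-1}\Sigma_{12}$, is the law of $x^2$ given $x^1=b$ under $\mathcal{N}(0,\Sigma)$. The measure $\hat\mu^{\varepsilon=0}=\mathcal{N}(\hat m,\hat\Sigma)$ has mean $\hat m=-\hat M^{-1}(\alpha M_{11}+M_{21})b$ and covariance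 $\hat\Sigma$, the unique positive definite solution of $\hat M\hat\Sigma+\hat\Sigma\hat M^T=-2\hat C\hat C^T$. It is the invariant measure of the component $Y^2$ of $dY_t=PMY_t\,dt+\sqrt2\,PC\,dW_t$ with $Y^1_t\equiv Y^1_0=b$. *)

(* Defs.v *)
From HB Require Import structures.
From mathcomp Require Import all_boot all_order all_algebra.
From mathcomp Require Import all_classical all_reals all_analysis.
From mathcomp Require Import measurable_realfun complex.

Set Implicit Arguments.
Unset Strict Implicit.
Unset Printing Implicit Defensive.

Import Order.TTheory GRing.Theory Num.Theory.
Import numFieldNormedType.Exports.

Local Open Scope classical_set_scope.
Local Open Scope ring_scope.

Section linear_systems.
Variable R : realType.

Definition hurwitz r (M : 'M[R]_r) : Prop :=
  forall z : R[i]%C,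
    eigenvalue (map_mx (real_complex R) M) z -> complex.Re z < 0.

Definition controllable r n (M : 'M[R]_r) (C : 'M[R]_(r, n)) : Prop :=
  \rank (\mxrow_(j < r) (M ^+ j *m C)) = r.

Definition sym_posdef r (S : 'M[R]_r) : Prop :=
  S^T = S /\ forall x : 'cV[R]_r, x != 0 -> 0 < (x^T *m S *m x) 0 0.

(* For M Hurwitz and (M, C) controllable there is exactly one such S. *)
Definition lyapunov_cov r n (M : 'M[R]_r) (C : 'M[R]_(r, n)) (S : 'M[R]_r) :
    Prop :=
  sym_posdef S /\ M *m S + S *m M^T = - (2 *: (C *m C^T)).

Definition sym_part r n (C : 'M[R]_(r, n)) : 'M[R]_r := C *m C^T.

Definition skew_part r (M S : 'M[R]_r) : 'M[R]_r :=
  2^-1 *: (M *m S - S *m M^T).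

Lemma lyapunov_decomp r n (M : 'M[R]_r) (C : 'M[R]_(r, n)) (S : 'M[R]_r) :
  lyapunov_cov M C S -> M = (skew_part M S - sym_part C) *m invmx S.
Proof.
move=> [[_ Spos] Seq].
have Su : S \in unitmx.
  rewrite -row_free_unit -kermx_eq0; apply/rowV0P => v /sub_kermxP vS0.
  apply/eqP/negPn/negP => v0.
  have /Spos : v^T != 0 by rewrite trmx_eq0.
  by rewrite trmxK vS0 mul0mx mxE ltxx.
rewrite -[LHS](mulmxK Su); congr (_ *m _); apply: (scalerI (a := (2 : R))).
  by rewrite pnatr_eq0.
rewrite scalerBr scalerA divff ?pnatr_eq0// scale1r -Seq.
by rewrite addrACA addNr addr0 scaler_nat mulr2n.
Qed.

End linear_systems.

Section blocks.
Variables (R : realType) (k l : nat).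
Implicit Types M K S : 'M[R]_(k + l).

Definition alpha K : 'M[R]_(l, k) := - (dlsubmx K *m invmx (ulsubmx K)).

Definition Mhat K M : 'M[R]_l := alpha K *m ursubmx M + drsubmx M.

Definition Chat K n1 n2 (C : 'M[R]_(k + l, n1 + n2)) : 'M[R]_(l, n1 + n2) :=
  row_mx (alpha K *m ulsubmx C + dlsubmx C) (alpha K *m ursubmx C + drsubmx C).

Definition projP K : 'M[R]_(k + l) := block_mx 0 0 (alpha K) 1%:M.

Lemma MhatE K M : Mhat K M = drsubmx (projP K *m M).
Proof. by rewrite -[M in RHS]submxK mulmx_block block_mxKdr mul1mx. Qed.

Lemma ChatE K n1 n2 (C : 'M[R]_(k + l, n1 + n2)) :
  Chat K C = dsubmx (projP K *m C).
Proof.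
by rewrite -[C in RHS]submxK mulmx_block block_mxEv col_mxKd !mul1mx.
Qed.

Definition mhat K M (b : 'cV[R]_k) : 'cV[R]_l :=
  - (invmx (Mhat K M) *m (alpha K *m ulsubmx M + dlsubmx M) *m b).

Definition cond_mean S (b : 'cV[R]_k) : 'cV[R]_l :=
  dlsubmx S *m invmx (ulsubmx S) *m b.

Definition cond_cov S : 'M[R]_l :=
  drsubmx S - dlsubmx S *m invmx (ulsubmx S) *m ursubmx S.

End blocks.

Section lebesgue_tuple.
Local Open Scope ereal_scope.
Variable R : realType.
Local Notation mR := (measurableTypeR R).

Section step.
Variables (n : nat) (mu : {sigma_finite_measure set (n.-tuple mR) -> \bar R}).

Let cons_tuple (p : mR * n.-tuple mR) : n.+1.-tuple mR :=
  [tuple of p.1 :: p.2].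

Let measurable_cons_tuple : measurable_fun setT cons_tuple.
Proof. exact: measurable_cons. Qed.

Definition lebesgue_cons : set (n.+1.-tuple mR) -> \bar R :=
  pushforward (@lebesgue_measure R \x mu) cons_tuple.

Let measurable_preimage A : measurable A -> measurable (cons_tuple @^-1` A).
Proof.
by move=> mA; rewrite -[X in measurable X]setTI; exact: measurable_cons_tuple.
Qed.

Let lebesgue_cons0 : lebesgue_cons set0 = 0.
Proof. by rewrite /lebesgue_cons /pushforward preimage_set0 measure0. Qed.

Let lebesgue_cons_ge0 A : 0 <= lebesgue_cons A.
Proof. exact: measure_ge0. Qed.

Let lebesgue_cons_sigma_additive : semi_sigma_additive lebesgue_cons.
Proof.
move=> F mF tF mUF; rewrite /lebesgue_cons /pushforward preimage_bigcup.
apply: measure_semi_sigma_additive.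
- by move=> i; exact: measurable_preimage.
- apply/trivIsetP => i j _ _ ij; rewrite -preimage_setI.
  by move/trivIsetP : tF => ->//; rewrite preimage_set0.
- by rewrite -preimage_bigcup; exact: measurable_preimage.
Qed.

HB.instance Definition _ := isMeasure.Build _ _ _ lebesgue_cons
  lebesgue_cons0 lebesgue_cons_ge0 lebesgue_cons_sigma_additive.

Let lebesgue_cons_sigma_finite : sigma_finite setT lebesgue_cons.
Proof.
have /sigma_finiteP[F [FT ndF Foo]] := sigma_finiteT (@lebesgue_measure R).
have /sigma_finiteP[G [GT ndG Goo]] := sigma_finiteT mu.
pose uncons (t : n.+1.-tuple mR) : mR * n.-tuple mR := (thead t, [tuple of behead t]).
have unconsK p : uncons (cons_tuple p) = p.
  by case: p => x t; congr pair; exact: val_inj.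
have munc : measurable_fun setT uncons.
  apply/measurable_fun_pairP; split; last exact: measurable_behead.
  exact: measurable_tnth.
exists (fun i => uncons @^-1` (F i `*` G i)) => [|i].
  apply/esym/seteqP; split => // t _.
  have [i _ Fi] : (\bigcup_i F i) (uncons t).1 by rewrite -FT.
  have [j _ Gj] : (\bigcup_j G j) (uncons t).2 by rewrite -GT.
  exists (maxn i j) => //; split.
  - by move: Fi; exact/subsetPset/ndF/leq_maxl.
  - by move: Gj; exact/subsetPset/ndG/leq_maxr.
have [mFi Fi_fin] := Foo i; have [mGi Gi_fin] := Goo i; split.
  rewrite -[X in measurable X]setTI; apply: munc => //; exact: measurableX.
rewrite /lebesgue_cons /pushforward -comp_preimage.
rewrite (_ : uncons \o cons_tuple = id); last exact/funext/unconsK.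
by rewrite preimage_id product_measure1E// lte_mul_pinfty// ge0_fin_numE.
Qed.

HB.instance Definition _ := Measure_isSigmaFinite.Build _ _ _ lebesgue_cons
  lebesgue_cons_sigma_finite.

End step.

Fixpoint lebesgue_tuple n :
    {sigma_finite_measure set (n.-tuple mR) -> \bar R} :=
  match n with
  | 0 => dirac [tuple]
  | n'.+1 => lebesgue_cons (lebesgue_tuple n')
  end.

End lebesgue_tuple.

Section gaussian.
Variables (R : realType) (n : nat).
Local Notation mR := (measurableTypeR R).
Implicit Types (m : 'cV[R]_n) (S : 'M[R]_n).

Definition gaussian_pdf m S (x : n.-tuple mR) : R :=
  let y := \col_i tnth x i - m in
  (Num.sqrt ((2 * pi) ^+ n * \det S))^-1 *
  expR (- (2^-1 * (y^T *m invmx S *m y) 0 0)).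

(* Meaningful for S symmetric positive definite only. *)
Definition gaussian m S (A : set (n.-tuple mR)) : \bar R :=
  (\int[lebesgue_tuple R n]_(x in A) (gaussian_pdf m S x)%:E)%E.

Section measure.
Variables (m : 'cV[R]_n) (S : 'M[R]_n).

Lemma gaussian_pdf_ge0 x : 0 <= gaussian_pdf m S x.
Proof. by rewrite mulr_ge0 ?invr_ge0 ?sqrtr_ge0 ?expR_ge0. Qed.

Lemma measurable_gaussian_pdf : measurable_fun setT (gaussian_pdf m S).
Proof.
have mc i : measurable_fun [set: n.-tuple mR]
    (fun x => (\col_i tnth x i - m) i 0 : R).
  rewrite (_ : (fun x => _) = (fun x : n.-tuple mR => tnth x i - m i 0)).
    by apply: measurable_funB; [exact: measurable_tnth|exact: measurable_cst].
  by apply/funext => x; rewrite !mxE.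
apply: measurable_funM; first exact: measurable_cst.
apply: measurableT_comp => //; apply: measurableT_comp => //.
apply: measurable_funM; first exact: measurable_cst.
rewrite (_ : (fun x => _) = (fun x : n.-tuple mR =>
  \sum_j (\sum_i ((\col_i tnth x i - m) i 0 * invmx S i j)) *
          (\col_i tnth x i - m) j 0)).
  apply: measurable_sum => j; apply: measurable_funM; last exact: mc.
  by apply: measurable_sum => i; apply: measurable_funM.
apply/funext => x; rewrite mxE; apply: eq_bigr => j _; rewrite mxE.
by congr (_ * _); apply: eq_bigr => i _; rewrite mxE.
Qed.

Let gaussian0 : gaussian m S set0 = 0%E.
Proof. by rewrite /gaussian integral_set0. Qed.

Let gaussian_ge0 A : (0 <= gaussian m S A)%E.
Proof. by apply: integral_ge0 => x _; rewrite lee_fin gaussian_pdf_ge0. Qed.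

Let gaussian_sigma_additive : semi_sigma_additive (gaussian m S).
Proof.
move=> F mF tF mUF; rewrite /gaussian ge0_integral_bigcup//; first last.
- by move=> x _; rewrite lee_fin gaussian_pdf_ge0.
- apply/measurable_EFinP; apply: measurable_funTS.
  exact: measurable_gaussian_pdf.
apply: is_cvg_ereal_nneg_natsum_cond => i _ _.
by apply: integral_ge0 => x _; rewrite lee_fin gaussian_pdf_ge0.
Qed.

HB.instance Definition _ := isMeasure.Build _ _ _ (gaussian m S)
  gaussian0 gaussian_ge0 gaussian_sigma_additive.

End measure.
End gaussian.

(* Main.v *)
Require Import Defs.
From mathcomp Require Import all_boot all_order all_algebra.
From mathcomp Require Import all_classical all_reals all_analysis.
From mathcomp Require Import complex lra.

Import Order.TTheory GRing.Theory Num.Theory.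
Local Open Scope ring_scope.

(** The fast block is eliminated by the matrix P = [0 0; alpha I], and alpha is
    chosen so that P annihilates the first k columns of K: writing
    K/K11 = K22 - K21 K11^-1 K12 for the Schur complement ([cond_cov K]),
    one has P K = [0 0; 0 K/K11].  Similarly P M = [0 0; N Mhat] with
    N = alpha M11 + M21, and Chat is the bottom of P C.

    When K = A - J the decomposition of the drift reads M S = - K.  Multiplying
    by P and comparing bottom blocks gives N S11 + Mhat S21 = 0 and
    N S12 + Mhat S22 = - K/K11.  The first equation is the equality of means
    - Mhat^-1 N b = S21 S11^-1 b; eliminating N from the second one leaves
    Mhat (S/S11) = - K/K11, which is the bottom right block of P (M S) P^T.

    When K = S, the matrix P (M S) P^T = (P M) (P S)^T has Mhat (S/S11) as
    its bottom right block.  So in both cases Mhat (S/S11) is the bottom right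
    block of P (M S) P^T, and adding the transposed identity turns the Lyapunov
    equation of S into that of S/S11 for the reduced system
    ([cond_cov_lyapunov]).  As Mhat is Hurwitz, that equation has only one
    solution ([lyapunov_unique], a case of Sylvester's theorem
    [sylvester_eq0]), whence Shat = S/S11.

    For the means to differ when K = S, take S = C = I: then alpha = 0, the
    conditional mean vanishes, and mhat = - M22^-1 M21 b is nonzero as soon as
    M = - I + skew-symmetric has M21 b <> 0. *)

(** * Sylvester and Lyapunov equations *)

(** X intertwines A and B, so it is annihilated by the characteristic
    polynomial of A evaluated at A.  The linear factors A - z can be removed one
    at a time: a nonzero row of X with X (B - z) = 0 would be an eigenvector of
    B for the eigenvalue z of A. *)
Lemma sylvester_eq0 (F : closedFieldType) (r s : nat) (A : 'M[F]_r)
    (B : 'M[F]_s) (X : 'M[F]_(r, s)) :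
  (forall z, eigenvalue A z -> ~~ eigenvalue B z) ->
  A *m X = X *m B -> X = 0.
Proof.
case: r A X => [|r] A X disj AXB; first exact: flatmx0.
have [rs] := closed_field_poly_normal (char_poly A).
rewrite (monicP (char_poly_monic A)) scale1r => charA.
have rs_disj z : z \in rs -> ~~ eigenvalue B z.
  by move=> zrs; apply: disj; rewrite eigenvalue_root_char charA root_prod_XsubC.
have : horner_mx A (\prod_(z <- rs) ('X - z%:P)) *m X = 0.
  by rewrite -charA Cayley_Hamilton mul0mx.
(* A - z commutes with A, so (A - z) X is again an intertwiner: this is what
   makes the induction on the list of roots go through. *)
elim: rs rs_disj X AXB {charA} => [_ X _|z rs IHrs rs_disj X AXB].
  by rewrite big_nil rmorph1 mul1mx.
have AzX : (A - z%:M) *m X = X *m (B - z%:M).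
  by rewrite mulmxBl mulmxBr AXB scalar_mxC.
rewrite big_cons mulrC rmorphM rmorphB /= horner_mx_X horner_mx_C.
rewrite -[in X in X -> _]mulmxA => /IHrs /= AzX0.
have {}AzX0 : (A - z%:M) *m X = 0.
  apply: AzX0 => [w wrs|]; first by apply: rs_disj; rewrite inE wrs orbT.
  rewrite {1}AzX mulmxA AXB AzX -!mulmxA; congr (X *m _).
  by rewrite mulmxBl mulmxBr scalar_mxC.
apply/row_matrixP => i; rewrite row0; apply/eqP.
apply: contraNT (rs_disj z (mem_head _ _)) => Xi0.
apply/eigenvalueP; exists (row i X) => //.
apply/eqP; rewrite -subr_eq0 -mul_mx_scalar -mulmxBr -row_mul -AzX AzX0.
by rewrite row0.
Qed.

Lemma eigenvalue_tr (F : fieldType) (r : nat) (A : 'M[F]_r) (z : F) :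
  eigenvalue A^T z = eigenvalue A z.
Proof.
rewrite !eigenvalue_root_char; congr (root _ z).
rewrite /char_poly -det_tr /char_poly_mx linearB /= tr_scalar_mx.
by rewrite map_trmx trmxK.
Qed.

(** The difference D of two solutions intertwines M and - M^T, whose spectra lie
    in opposite open half planes. *)
Lemma lyapunov_unique (R : realType) (r : nat) (M X Y : 'M[R]_r) :
  hurwitz M -> M *m X + X *m M^T = M *m Y + Y *m M^T -> X = Y.
Proof.
move=> hM eXY; apply/eqP; rewrite -subr_eq0; apply/eqP.
apply: (@map_mx_inj _ _ (real_complex R)); rewrite map_mx0.
pose Mc := map_mx (real_complex R) M.
apply: (@sylvester_eq0 _ _ _ Mc (- Mc^T)).
  move=> z /hM z_lt0; apply/negP => /eigenvalueP[v vM v0].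
  have /hM : eigenvalue Mc (- z).
    rewrite -eigenvalue_tr; apply/eigenvalueP; exists v => //.
    by rewrite scaleNr -vM mulmxN opprK.
  by rewrite raddfN /= oppr_lt0 ltNge ltW.
rewrite mulmxN map_trmx -mulNmx -raddfN -!map_mxM /=; congr map_mx.
move/eqP: eXY; rewrite -subr_eq0 opprD addrACA -mulmxBr -mulmxBl addr_eq0.
by move/eqP; rewrite mulNmx.
Qed.

Lemma hurwitz_unitmx (R : realType) (r : nat) (M : 'M[R]_r) :
  hurwitz M -> M \in unitmx.
Proof.
move=> hM; rewrite -row_free_unit -kermx_eq0; apply/rowV0P => v /sub_kermxP vM0.
apply/eqP/negPn/negP => v0.
have /hM : eigenvalue (map_mx (real_complex R) M) 0.
  apply/eigenvalueP; exists (map_mx (real_complex R) v).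
    by rewrite -map_mxM vM0 map_mx0 scale0r.
  by rewrite map_mx_eq0.
by rewrite ltxx.
Qed.

(** * Positive definite matrices *)

Lemma sym_posdef_unitmx (R : realType) (r : nat) (S : 'M[R]_r) :
  sym_posdef S -> S \in unitmx.
Proof.
move=> [_ Spos].
rewrite -row_free_unit -kermx_eq0; apply/rowV0P => v /sub_kermxP vS0.
apply/eqP/negPn/negP => v0.
have /Spos : v^T != 0 by rewrite trmx_eq0.
by rewrite trmxK vS0 mul0mx mxE ltxx.
Qed.

Lemma sym_posdef_ulsubmx (R : realType) (k l : nat) (S : 'M[R]_(k + l)) :
  sym_posdef S -> sym_posdef (ulsubmx S).
Proof.
move=> [sS Spos]; split=> [|x x0]; first by rewrite trmx_ulsub sS.
have /Spos : col_mx x (0 : 'cV_l) != 0 by rewrite col_mx_eq0 negb_and x0.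
rewrite -[S in X in X -> _]submxK tr_col_mx mul_row_block mul_row_col.
by rewrite trmx0 !mul0mx mulmx0 !addr0.
Qed.

(** * Elimination of the first block *)

Section schur.
Variables (R : realType) (k l : nat).
Implicit Types K M S : 'M[R]_(k + l).

Lemma projP_mulmx K M :
  projP K *m M =
  block_mx 0 0 (alpha K *m ulsubmx M + dlsubmx M) (Mhat K M).
Proof.
by rewrite -[M in LHS]submxK mulmx_block !mul0mx !addr0 !mul1mx.
Qed.

(** Block elimination: [cond_cov K] is read here as a Schur complement of the
    drift parameter K, not as the covariance of a conditioned Gaussian. *)
Lemma projP_mulmx_self K :
  ulsubmx K \in unitmx -> projP K *m K = block_mx 0 0 0 (cond_cov K).
Proof.
move=> Ku; rewrite projP_mulmx /Mhat /cond_cov /alpha mulNmx mulmxKV// addNr.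
by rewrite mulNmx addrC.
Qed.

Lemma tr_cond_cov S : S^T = S -> (cond_cov S)^T = cond_cov S.
Proof.
move=> sS; rewrite /cond_cov linearB /= !trmx_mul trmx_inv.
by rewrite trmx_drsub trmx_ulsub trmx_ursub trmx_dlsub sS mulmxA.
Qed.

(** Adding its transpose to the last hypothesis gives the bottom right block of
    P (M S + S M^T) P^T = - 2 (P C) (P C)^T.  That hypothesis is the point where
    K = A - J and K = S meet: it holds in both cases, for different reasons. *)
Lemma cond_cov_lyapunov n1 n2 K M (C : 'M[R]_(k + l, n1 + n2)) S :
    S^T = S -> M *m S + S *m M^T = - (2 *: (C *m C^T)) ->
    Mhat K M *m cond_cov S = drsubmx (projP K *m (M *m S) *m (projP K)^T) ->
  Mhat K M *m cond_cov S + cond_cov S *m (Mhat K M)^T =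
  - (2 *: (Chat K C *m (Chat K C)^T)).
Proof.
move=> sS lyap MSc.
rewrite -[X in _ + X *m _]tr_cond_cov// -trmx_mul MSc.
rewrite trmx_drsub.
have -> : (projP K *m (M *m S) *m (projP K)^T)^T =
    projP K *m (S *m M^T) *m (projP K)^T.
  by rewrite !trmx_mul trmxK sS !mulmxA.
rewrite -!linearD /= -mulmxDl -mulmxDr lyap ChatE.
rewrite mulmxN mulNmx -scalemxAr -scalemxAl.
have -> : projP K *m (C *m C^T) *m (projP K)^T =
    (projP K *m C) *m (projP K *m C)^T by rewrite trmx_mul !mulmxA.
rewrite -[projP K *m C]vsubmxK tr_col_mx mul_col_row col_mxKd.
rewrite scale_block_mx opp_block_mx; exact: block_mxKdr.
Qed.

(** These are the two bottom blocks of P M S = - P K; the lower left one is zero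
    on the right because P annihilates the first columns of K. *)
Lemma projP_blocks_of_factor K M S :
    ulsubmx K \in unitmx -> M *m S = - K ->
  (alpha K *m ulsubmx M + dlsubmx M) *m ulsubmx S = - (Mhat K M *m dlsubmx S)
  /\ (alpha K *m ulsubmx M + dlsubmx M) *m ursubmx S + Mhat K M *m drsubmx S =
     - cond_cov K.
Proof.
move=> Ku MSK; have := congr1 (mulmx (projP K)) MSK.
rewrite mulmxN projP_mulmx_self// mulmxA projP_mulmx -[X in _ *m X]submxK.
rewrite mulmx_block opp_block_mx => /eq_block_mx[_ _ + ->].
by rewrite oppr0 => /eqP; rewrite addr_eq0 => /eqP.
Qed.

Lemma mhat_eq_cond_mean K M S b :
    ulsubmx K \in unitmx -> ulsubmx S \in unitmx -> Mhat K M \in unitmx ->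
    M *m S = - K ->
  mhat K M b = cond_mean S b.
Proof.
move=> Ku Su Mu /projP_blocks_of_factor -/(_ Ku)[NS _].
rewrite /mhat /cond_mean -(mulmxK Su (_ + _)) NS !mulNmx mulmxN mulNmx opprK.
by rewrite !mulmxA mulVmx// mul1mx.
Qed.

Lemma Mhat_mul_cond_cov K M S :
    ulsubmx K \in unitmx -> ulsubmx S \in unitmx -> M *m S = - K ->
  Mhat K M *m cond_cov S = - cond_cov K.
Proof.
move=> Ku Su /projP_blocks_of_factor -/(_ Ku)[NS <-].
rewrite /cond_cov mulmxBr addrC; congr (_ + _).
by rewrite -[in RHS](mulmxK Su (_ + _)) NS !mulNmx !mulmxA.
Qed.

Lemma projP_congruence K :
  ulsubmx K \in unitmx ->
  projP K *m K *m (projP K)^T = block_mx 0 0 0 (cond_cov K).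
Proof.
move=> Ku; rewrite projP_mulmx_self// tr_block_mx !trmx0 trmx1 mulmx_block.
by rewrite !(mul0mx, mulmx0, add0r) mulmx1.
Qed.

End schur.

(** * Data for which the means differ *)

(** If v M = z v then v (M + M^T) v^* = 2 Re(z) |v|^2, so Re(z) = -1. *)
Lemma hurwitz_lyapunov1 (R : realType) (r : nat) (M : 'M[R]_r) :
  M + M^T = - 2%:M -> hurwitz M.
Proof.
move=> MMT z /eigenvalueP[v vM v0].
pose w := map_mx (@conjc R) v^T.
have vw_gt0 : 0 < (v *m w) 0 0.
  have E : (v *m w) 0 0 = \sum_i `|v 0 i| ^+ 2.
    by rewrite mxE; apply: eq_bigr => i _; rewrite !mxE sqr_normc.
  rewrite E lt_neqAle sumr_ge0 ?andbT => [|i _]; last by rewrite exprn_ge0.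
  rewrite eq_sym psumr_neq0 => [|i _]; last by rewrite exprn_ge0.
  have /rV0Pn[i vi0] := v0.
  by apply/hasP; exists i; rewrite ?mem_index_enum//= exprn_gt0// normr_gt0.
have MTw : map_mx (real_complex R) M^T *m w = (conjc z) *: w.
  rewrite /w -map_mxZ -linearZ /= -vM trmx_mul map_mxM -map_trmx; congr (_ *m _).
  by apply/matrixP => i j; rewrite !mxE /= oppr0.
have : v *m map_mx (real_complex R) (M + M^T) *m w = (z + conjc z) *: (v *m w).
  rewrite map_mxD mulmxDr mulmxDl vM -scalemxAl -mulmxA MTw -scalemxAr.
  by rewrite -scalerDl.
rewrite MMT map_mxN map_scalar_mx mulmxN mul_mx_scalar mulNmx -scalemxAl.
rewrite -scaleNr => /matrixP/(_ 0 0); rewrite [LHS]mxE [RHS]mxE.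
move/(mulIf (lt0r_neq0 vw_gt0)).
case: z {vM MTw} => a c /(congr1 (@complex.Re R)) /= aa; lra.
Qed.

(** The block of index 0 of the controllability matrix is C itself. *)
Lemma rank_controllable (R : realType) (r n : nat) (M : 'M[R]_r)
    (C : 'M[R]_(r, n)) :
  \rank C = r -> controllable M C.
Proof.
case: r M C => [|r] M C rC.
  by apply/eqP; rewrite -leqn0 rank_leq_row.
apply/eqP; rewrite eqn_leq rank_leq_row /= -{1}rC.
rewrite -[in leqRHS]mxrank_tr tr_mxrow -mxrank_tr.
apply: mxrankS; rewrite eqmx_col (sumsmx_sup ord0)// genmxE.
by rewrite expr0 mul1mx.
Qed.

Lemma scalar1_sym_posdef (R : realType) (r : nat) : sym_posdef (1%:M : 'M[R]_r).
Proof.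
split=> [|x x0]; first exact: tr_scalar_mx.
have E : (x^T *m 1%:M *m x) 0 0 = \sum_i x i 0 ^+ 2.
  by rewrite mulmx1 mxE; apply: eq_bigr => i _; rewrite !mxE expr2.
rewrite E lt_neqAle sumr_ge0 ?andbT => [|i _]; last exact: sqr_ge0.
rewrite eq_sym psumr_neq0 => [|i _]; last exact: sqr_ge0.
have /cV0Pn[i xi0] := x0.
by apply/hasP; exists i; rewrite ?mem_index_enum//= exprn_even_gt0.
Qed.

Section counterexample.
Variables (R : realType) (k l : nat).

(** With C = I the Lyapunov equation has the solution S = I exactly when the
    symmetric part of M is - I.  The skew-symmetric part is free, and feeds the
    first block into the second through M21, all of whose entries are 1. *)
Definition rotating_drift : 'M[R]_(k + l) :=
  block_mx (- 1%:M) (- (const_mx 1)^T) (const_mx 1) (- 1%:M).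

Lemma rotating_driftDtr : rotating_drift + rotating_drift^T = - 2%:M.
Proof.
rewrite /rotating_drift tr_block_mx add_block_mx.
rewrite [in RHS]scalar_mx_block opp_block_mx !linearN /= !tr_scalar_mx trmxK.
by rewrite addNr subrr !oppr0 -!opprD -!raddfD.
Qed.

Lemma alpha1 : alpha (1%:M : 'M[R]_(k + l)) = 0.
Proof.
by rewrite /alpha scalar_mx_block block_mxKdl mul0mx oppr0.
Qed.

Lemma Mhat_rotating : Mhat 1%:M rotating_drift = - 1%:M.
Proof. by rewrite /Mhat alpha1 mul0mx add0r block_mxKdr. Qed.

Lemma rank_Chat1 : \rank (Chat 1%:M (1%:M : 'M[R]_(k + l))) = l.
Proof.
rewrite /Chat alpha1 !mul0mx !add0r scalar_mx_block block_mxKdl block_mxKdr.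
by rewrite rank_row_0mx mxrank1.
Qed.

Lemma mhat_rotating : (0 < k)%N -> (0 < l)%N ->
  mhat 1%:M rotating_drift (const_mx 1) <>
  cond_mean (1%:M : 'M[R]_(k + l)) (const_mx 1).
Proof.
move=> k_gt0 l_gt0.
rewrite /mhat Mhat_rotating alpha1 mul0mx add0r block_mxKdl.
rewrite /cond_mean [X in dlsubmx X]scalar_mx_block block_mxKdl !mul0mx.
have -> : - 1%:M = (-1)%:M :> 'M[R]_l by rewrite raddfN.
rewrite invmx_scalar invrN1 raddfN /=.
move=> /matrixP/(_ (Ordinal l_gt0) 0).
rewrite mulNmx mul1mx mulNmx opprK !mxE.
under eq_bigr do rewrite !mxE mulr1.
move/eqP.
by rewrite sumr_const card_ord pnatr_eq0 eqn0Ngt k_gt0.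
Qed.

End counterexample.

Theorem proposition4p3 (R : realType) (k l : nat) (k_gt0 : (0 < k)%N)
    (l_gt0 : (0 < l)%N) :
  (forall (n1 n2 : nat) (M : 'M[R]_(k + l)) (C : 'M[R]_(k + l, n1 + n2))
      (S : 'M[R]_(k + l)) (b : 'cV[R]_k) (K : 'M[R]_(k + l))
      (Shat : 'M[R]_l),
    hurwitz M -> controllable M C -> lyapunov_cov M C S ->
    hurwitz (- ulsubmx K) ->
    hurwitz (Mhat K M) -> controllable (Mhat K M) (Chat K C) ->
    lyapunov_cov (Mhat K M) (Chat K C) Shat ->
    let A := sym_part C in
    let J := skew_part M S in
    let mu_hat := gaussian (mhat K M b) Shat in
    let mu_c := gaussian (cond_mean S b) (cond_cov S) in
    [/\ K = A - J -> mu_hat = mu_c,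
        J = 0 -> K = A -> mu_hat = mu_c &
        K = S -> Shat = cond_cov S]) /\
  (exists (n1 n2 : nat) (M : 'M[R]_(k + l)) (C : 'M[R]_(k + l, n1 + n2))
      (S : 'M[R]_(k + l)) (b : 'cV[R]_k) (K : 'M[R]_(k + l)),
    [/\ hurwitz M, controllable M C & lyapunov_cov M C S] /\
    [/\ hurwitz (- ulsubmx K), hurwitz (Mhat K M) &
        controllable (Mhat K M) (Chat K C)] /\
    [/\ K = S, b <> 0 & mhat K M b <> cond_mean S b]).
Proof.
split.
  move=> n1 n2 M C S b K Shat _ _ lyapS hK hMhat _ lyapShat A J mu_hat mu_c.
  have [Spos Seq] := lyapS; have [sS _] := Spos.
  have [_ Shateq] := lyapShat.
  have Ku : ulsubmx K \in unitmx.
    by rewrite -[ulsubmx K]opprK -scaleN1r unitmxZ ?unitrN1// hurwitz_unitmx.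
  have cov_eq :
      Mhat K M *m cond_cov S = drsubmx (projP K *m (M *m S) *m (projP K)^T) ->
      Shat = cond_cov S.
    move=> MSc; apply: (lyapunov_unique _ _ (Mhat K M)) => //.
    by rewrite Shateq (cond_cov_lyapunov _ _ _ _ _ _ _ C).
  have mu_eq : K = A - J -> mu_hat = mu_c.
    move=> KE.
    have Su := sym_posdef_unitmx _ _ _ (sym_posdef_ulsubmx _ _ _ _ Spos).
    have MSK : M *m S = - K.
      rewrite KE opprB {1}(lyapunov_decomp lyapS) mulmxKV//.
      exact: sym_posdef_unitmx.
    have mean_eq : mhat K M b = cond_mean S b.
      by apply: mhat_eq_cond_mean => //; exact: hurwitz_unitmx.
    rewrite /mu_hat mean_eq cov_eq; first reflexivity.
    rewrite MSK mulmxN mulNmx projP_congruence// opp_block_mx.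
    by rewrite block_mxKdr Mhat_mul_cond_cov.
  split; [exact: mu_eq| |move=> KS].
    by move=> J0 KA; apply: mu_eq; rewrite J0 subr0.
  apply: cov_eq.
  have -> : projP K *m (M *m S) *m (projP K)^T =
      (projP K *m M) *m (projP K *m K)^T.
    by rewrite KS trmx_mul sS !mulmxA.
  rewrite (projP_mulmx_self _ _ _ K Ku) projP_mulmx.
  rewrite tr_block_mx !trmx0 mulmx_block !(mul0mx, mulmx0, add0r).
  by rewrite block_mxKdr KS tr_cond_cov.
exists k, l, (rotating_drift R k l), 1%:M, 1%:M, (const_mx 1), 1%:M.
have hN1 r : hurwitz (- 1%:M : 'M[R]_r).
  apply: hurwitz_lyapunov1.
  by rewrite linearN /= tr_scalar_mx -opprD -raddfD.
have ne := mhat_rotating R k l k_gt0 l_gt0.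
split; [split|split; split] => //.
- exact/hurwitz_lyapunov1/rotating_driftDtr.
- by apply: rank_controllable; rewrite mxrank1.
- split; first exact: scalar1_sym_posdef.
  by rewrite mulmx1 !mul1mx tr_scalar_mx rotating_driftDtr scale_scalar_mx mulr1.
- by rewrite scalar_mx_block block_mxKul.
- by rewrite Mhat_rotating.
- by apply: rank_controllable; rewrite rank_Chat1.
- by move=> b0; apply: ne; rewrite b0 /mhat /cond_mean !mulmx0 oppr0.
Qed.
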